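(* Let $X$ be a closed connected manifold and $f,g:X\to X$ self maps. Suppose that $\pi_1(X)$ is abelian, that the pair $f,g$ is coincidence essentially reducible, that $f_*$ and $g_*$ commute at the level of $\pi_1(X)$, that the pair $f,g$ is injective on essential boosts, and that $g_*:\pi_1(X)\to\pi_1(X)$ is invertible. Then the pair $f,g$ is coincidence essentially reducible to the gcd.
   Context: Maps are continuous and $f^n$ denotes the $n$-th iterate. $X$ is a closed connected manifold with base point $x_0$; the maps $f,g:X\to X$ are taken (without loss of generality, up to homotopy) to preserve $x_0$, with induced homomorphisms $f_*,g_*:\pi_1(X,x_0)\to\pi_1(X,x_0)$. Geometric classes: $\Phi(f^n,g^n)=\{x\in X: f^n(x)=g^n(x)\}$. Points $x,y\in\Phi(f^n,g^n)$ are Nielsen equivalent at level $n$ if there is a path $c$ from $x$ to $y$ with $f^n(c)\simeq g^n(c)$ relative to end points. Each Nielsen class $\mathbf A^n$ has an integer $\mathrm{ind}(\mathbf A^n)$, its coincidence index (the coincidence semi-index when $X$ is not orientable). Algebraic classes: $\mathcal R(f_*^n,g_*^n)$ is the set of Reidemeister classes $[\alpha]^n$, i.e. equivalence classes of $\pi_1(X,x_0)$ under $\alpha\sim\beta$ iff $\alpha=g_*^n(\gamma)\,\beta\,f_*^n(\gamma^{-1})$ for some $\gamma\in\pi_1(X,x_0)$. There is an injection $\rho_n$ from Nielsen classes to $\mathcal R(f_*^n,g_*^n)$ given by $\rho_n(\mathbf A^n)=[g^n(c)f^n(c^{-1})]^n$, where $c$ is any path from $x_0$ to any $x\in\mathbf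 A^n$. Put $\mathrm{Ind}([\alpha]^n)=\mathrm{ind}(\mathbf A^n)$ if $[\alpha]^n=\rho_n(\mathbf A^n)$ and $\mathrm{Ind}([\alpha]^n)=0$ otherwise. A class $[\alpha]^n$ is essential if $\mathrm{Ind}([\alpha]^n)\neq0$; $\mathcal E(f^n,g^n)\subseteq\mathcal R(f_*^n,g_*^n)$ is the set of essential classes. Boosting: when $f_*g_*=g_*f_*$ and $m\mid n$, $\iota_{m,n}:\mathcal R(f_*^m,g_*^m)\to\mathcal R(f_*^n,g_*^n)$ is induced by $$\iota_{m,n}(\alpha)=g_*^{n-m}(\alpha)\,g_*^{n-2m}f_*^{m}(\alpha)\cdots g_*^{m}f_*^{n-2m}(\alpha)\,f_*^{n-m}(\alpha)$$ (a sum when $\pi_1(X)$ is written additively). $[\alpha]^n$ reduces to $[\beta]^m$ if $m\mid n$ and $\iota_{m,n}([\beta]^m)=[\alpha]^n$. The pair $f,g$ is coincidence essentially reducible if, for every essential class $[\alpha]^n$ (any $n$), whenever $[\alpha]^n$ reduces to $[\beta]^m$, the class $[\beta]^m$ is also essential. A coincidence essentially reducible pair is injective on essential boosts if for all $n$, all $m\mid n$ and all classes $[\beta_1]^m,[\beta_2]^m$ with $\iota_{m,n}([\beta_1]^m)=\iota_{m,n}([\beta_2]^m)\in\mathcal E(f^n,g^n)$ one has $[\beta_1]^m=[\beta_2]^m$. The pair is coincidence essentially reducible to the gcd if it is coincidence essentially reducible and, whenever $[\alpha]^n\in\mathcal E(f^n,g^n)$ reduces to both $[\beta]^m\in\mathcal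 E(f^m,g^m)$ and $[\gamma]^k\in\mathcal E(f^k,g^k)$, there is a $[\delta]^d\in\mathcal E(f^d,g^d)$ with $d=\gcd(m,k)$ to which both $[\beta]^m$ and $[\gamma]^k$ reduce. *)

(* Defs.v *)
From HB Require Import structures.
From mathcomp Require Import all_boot all_order all_algebra generic_quotient.
From mathcomp Require Import all_classical all_reals topology normedtype.
From mathcomp Require Import continuous_path.
From mathcomp Require Import lra.
Set Implicit Arguments.
Unset Strict Implicit.
Unset Printing Implicit Defensive.
Import Order.TTheory GRing.Theory Num.Theory.
Import numFieldNormedType.Exports.
Local Open Scope classical_set_scope.
Local Open Scope ring_scope.
Local Open Scope quotient_scope.

Definition unit_itv (R : realType) := set_type `[0 : R, 1]%classic.

Section unit_interval.
Context (R : realType).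
Local Notation I := (unit_itv R).

HB.instance Definition _ := Topological.on I.

Definition ival (t : I) : R := set_val t.

Lemma clamp_subproof (t : R) :
  Num.max 0 (Num.min 1 t) \in `[0 : R, 1]%classic.
Proof.
by rewrite inE /= in_itv /= le_max lexx /= ge_max ler01 ge_min lexx.
Qed.

Definition clamp (t : R) : I :=
  exist (fun x => x \in `[0 : R, 1]%classic) _ (clamp_subproof t).

Lemma ival_inj : injective ival.
Proof. exact: val_inj. Qed.

Lemma clampE t : 0 <= t <= 1 -> ival (clamp t) = t.
Proof.
case/andP=> t0 t1; rewrite /ival set_valE /=.
by rewrite (min_r t1) (max_r t0).
Qed.

Lemma ival_itv t : 0 <= ival t <= 1.
Proof. by case: t => t; rewrite /ival set_valE /= inE /= in_itv. Qed.

Lemma ivalK : cancel ival clamp.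
Proof. by move=> t; apply: ival_inj; rewrite clampE// ival_itv. Qed.

Lemma clamp01 : clamp 0 != clamp 1.
Proof.
apply/eqP => /(congr1 ival); rewrite !clampE ?lexx ?ler01// => /eqP.
by rewrite eq_sym oner_eq0.
Qed.

HB.instance Definition _ := isBiPointed.Build I clamp01.

Lemma ival0 : ival zero = 0.
Proof. by rewrite /zero /= clampE// lexx ler01. Qed.

Lemma ival1 : ival one = 1.
Proof. by rewrite /one /= clampE// lexx ler01. Qed.

Lemma ival_continuous : continuous ival.
Proof. exact: initial_continuous. Qed.

Lemma clamp_continuous : continuous clamp.
Proof.
apply: continuous_comp_initial.
have -> : set_val \o clamp = (cst 0 : R -> R^o) \max (cst 1 \min id).
  by apply/funext => x; rewrite /= set_valE.
move=> t; apply: continuous_max; first exact: cvg_cst.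
by apply: continuous_min; [exact: cvg_cst | exact: cvg_id].
Qed.

End unit_interval.
Arguments clamp {R} t.


Section path_homotopy.
Context (R : realType) (X : topologicalType).
Local Notation I := (unit_itv R).

Definition path_homotopic (a b : I -> X) := exists H : (I * I)%type -> X,
  [/\ continuous H,
      forall t, H (zero, t) = a t /\ H (one, t) = b t
    & forall s, H (s, zero) = a zero /\ H (s, one) = a one].

Definition path_cat (a b : I -> X) : I -> X := fun t =>
  if ival t <= 2^-1 then a (clamp (2 * ival t)) else b (clamp (2 * ival t - 1)).

Definition path_rev (a : I -> X) : I -> X := fun t => a (clamp (1 - ival t)).

Lemma clamp0 : clamp 0 = zero :> I. Proof. by []. Qed.
Lemma clamp1 : clamp 1 = one :> I. Proof. by []. Qed.

Lemma half_lt1 : (1 : R) <= 2^-1 = false.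
Proof. by apply/negP/negP; rewrite -ltNge; lra. Qed.

Lemma half2 : 2 * 2^-1 = 1 :> R.
Proof. by rewrite mulfV// pnatr_eq0. Qed.

Lemma path_cat0 a b : path_cat a b zero = a zero.
Proof. by rewrite /path_cat ival0 mulr0 clamp0 invr_ge0 ler0n. Qed.

Lemma path_cat1 a b : path_cat a b one = b one.
Proof.
by rewrite /path_cat ival1 half_lt1 mulr1 (_ : 2 - 1 = 1 :> R) ?clamp1//; lra.
Qed.

Lemma path_rev0 a : path_rev a zero = a one.
Proof. by rewrite /path_rev ival0 subr0 clamp1. Qed.

Lemma path_rev1 a : path_rev a one = a zero.
Proof. by rewrite /path_rev ival1 subrr clamp0. Qed.

Lemma paste_continuous (T : topologicalType) (p : T -> R) (A B : T -> X) :
  continuous p -> continuous A -> continuous B ->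
  (forall t, p t = 2^-1 -> A t = B t) ->
  continuous (fun t => if p t <= 2^-1 then A t else B t).
Proof.
move=> cp cA cB AB; set h := fun t => _.
have cl1 : closed (p @^-1` [set x | x <= 2^-1]).
  by apply: preimage_closed => //; exact: closed_le.
have cl2 : closed (p @^-1` [set x | 2^-1 <= x]).
  by apply: preimage_closed => //; exact: closed_ge.
apply/continuous_subspace_setT.
have -> : [set: T] =
    p @^-1` [set x | x <= 2^-1] `|` p @^-1` [set x | 2^-1 <= x].
  apply/seteqP; split=> // t _ /=.
  by case: (leP (p t) 2^-1) => h'; [left|right; exact: ltW].
apply: withinU_continuous => //.
- apply: (@subspace_eq_continuous _ _ _ A); last exact: continuous_subspaceT.
  by move=> t; rewrite inE /= /from_subspace /h => ->.
- apply: (@subspace_eq_continuous _ _ _ B); last exact: continuous_subspaceT.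
  move=> t; rewrite inE /= /from_subspace /h => pt; case: ifPn => // pt'.
  by apply/esym/AB/eqP; rewrite eq_le pt pt'.
Qed.

Lemma clamp_comp (T : topologicalType) (p : T -> R) :
  continuous p -> continuous (clamp \o p : T -> I).
Proof.
by move=> cp t; apply: continuous_comp; [exact: cp|exact: clamp_continuous].
Qed.

Lemma comp2_continuous (T U V : topologicalType) (f : T -> U) (g : U -> V) :
  continuous f -> continuous g -> continuous (g \o f).
Proof. by move=> cf cg t; apply: continuous_comp; [exact: cf|exact: cg]. Qed.

Lemma affine_continuous (T : topologicalType) (p : T -> R) (k l : R) :
  continuous p -> continuous (fun t => k * p t + l).
Proof.
move=> cp t; apply: cvgD; last exact: cvg_cst.
by apply: cvgM; [exact: cvg_cst|exact: cp].
Qed.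

Lemma pair_continuous (T U V : topologicalType) (f : T -> U) (g : T -> V) :
  continuous f -> continuous g -> continuous (fun t => (f t, g t)).
Proof. by move=> cf cg t; apply: cvg_pair; [exact: cf|exact: cg]. Qed.

Lemma id_continuous : continuous (@id I).
Proof. by move=> t; exact: cvg_id. Qed.

Lemma fst_continuous (T U : topologicalType) : continuous (@fst T U).
Proof. by move=> t; exact: cvg_fst. Qed.

Lemma snd_continuous (T U : topologicalType) : continuous (@snd T U).
Proof. by move=> t; exact: cvg_snd. Qed.

Lemma clamp_affine_continuous (T : topologicalType) (p : T -> I) (k l : R) :
  continuous p -> continuous (fun t => clamp (k * ival (p t) + l) : I).
Proof.
move=> cp; apply: (@clamp_comp _ (fun t => k * ival (p t) + l)).
apply: (affine_continuous (p := fun t => ival (p t))) => t.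
by apply: continuous_comp; [exact: cp|exact: ival_continuous].
Qed.

Lemma clamp_mul_continuous (T : topologicalType) (p : T -> I) (k : R) :
  continuous p -> continuous (fun t => clamp (k * ival (p t)) : I).
Proof.
by move/(clamp_affine_continuous (k := k) (l := 0)); under eq_fun do rewrite addr0.
Qed.

Lemma clamp_rev_continuous (T : topologicalType) (p : T -> I) :
  continuous p -> continuous (fun t => clamp (1 - ival (p t)) : I).
Proof.
by move/(clamp_affine_continuous (k := -1) (l := 1)); under eq_fun do rewrite addrC mulN1r.
Qed.

Lemma path_cat_continuous a b : continuous a -> continuous b ->
  a one = b zero -> continuous (path_cat a b).
Proof.
move=> ca cb ab; apply: paste_continuous.
- exact: ival_continuous.
- exact: (comp2_continuous (clamp_mul_continuous (k := 2) id_continuous) ca).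
- exact: (comp2_continuous (clamp_affine_continuous (k := 2) (l := -1) id_continuous) cb).
- by move=> t ->; rewrite half2 subrr clamp1 clamp0.
Qed.

Lemma path_rev_continuous a : continuous a -> continuous (path_rev a).
Proof.
by move=> ca; exact: (comp2_continuous (clamp_rev_continuous id_continuous) ca).
Qed.

Lemma path_reparam (c : I -> X) (phi psi : I -> R) :
  continuous c -> continuous phi -> continuous psi ->
  phi zero = psi zero -> phi one = psi one ->
  path_homotopic (c \o clamp \o phi) (c \o clamp \o psi).
Proof.
move=> cc cphi cpsi e0 e1.
exists (c \o (clamp \o (fun z : I * I =>
  (1 - ival z.1) * phi z.2 + ival z.1 * psi z.2))); split.
- apply: comp2_continuous => //; apply: clamp_comp => z.
  have c1 : {for z, continuous (fun z : I * I => ival z.1)}.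
    by apply: continuous_comp; [exact: cvg_fst|exact: ival_continuous].
  apply: cvgD.
    apply: cvgM; first by apply: cvgB; [exact: cvg_cst|exact: c1].
    by apply: (@continuous_comp _ _ _ snd phi); [exact: cvg_snd|exact: cphi].
  apply: cvgM; first exact: c1.
  by apply: (@continuous_comp _ _ _ snd psi); [exact: cvg_snd|exact: cpsi].
- by move=> t /=; rewrite ival0 ival1 subr0 subrr !mul1r !mul0r addr0 add0r.
- by move=> s /=; rewrite e0 e1 -!mulrDl subrK !mul1r.
Qed.

Lemma path_homotopic_refl a : continuous a -> path_homotopic a a.
Proof.
move=> ca; exists (fun z => a z.2); split=> //.
exact: (comp2_continuous (@snd_continuous I I) ca).
Qed.

Lemma path_homotopic_sym a b : path_homotopic a b -> path_homotopic b a.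
Proof.
case=> H [cH H01 He]; exists (fun z => H (clamp (1 - ival z.1), z.2)); split.
- apply: (comp2_continuous (f := fun z : I * I => (clamp (1 - ival z.1), z.2))) cH.
  apply: pair_continuous; last exact: snd_continuous.
  exact: (clamp_rev_continuous (@fst_continuous I I)).
- move=> t /=; rewrite ival0 ival1 subr0 subrr clamp0 clamp1.
  by have [-> ->] := H01 t.
- move=> s /=; have [-> ->] := He (clamp (1 - ival s)).
  have [_ <-] := H01 zero; have [_ <-] := H01 one.
  by have [-> ->] := He one.
Qed.

Lemma path_homotopic_trans b a c :
  path_homotopic a b -> path_homotopic b c -> path_homotopic a c.
Proof.
case=> H [cH H01 He] [K [cK K01 Ke]].
have e0 : b zero = a zero by have [_ <-] := H01 zero; have [-> _] := He one.
have e1 : b one = a one by have [_ <-] := H01 one; have [_ ->] := He one.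
exists (fun z => if ival z.1 <= 2^-1 then H (clamp (2 * ival z.1), z.2)
                 else K (clamp (2 * ival z.1 - 1), z.2)); split.
- apply: paste_continuous.
  + exact: (comp2_continuous (@fst_continuous I I) (@ival_continuous R)).
  + apply: (comp2_continuous (f := fun z : I * I => (clamp (2 * ival z.1), z.2))) cH.
    apply: pair_continuous; last exact: snd_continuous.
    exact: (clamp_mul_continuous (@fst_continuous I I)).
  + apply: (comp2_continuous (f := fun z : I * I => (clamp (2 * ival z.1 - 1), z.2))) cK.
    apply: pair_continuous; last exact: snd_continuous.
    exact: (clamp_affine_continuous (@fst_continuous I I)).
  + move=> z ->; rewrite half2 subrr clamp1 clamp0.
    by have [_ ->] := H01 z.2; have [-> _] := K01 z.2.
- move=> t /=; rewrite ival0 ival1 half_lt1 invr_ge0 ler0n mulr0 mulr1.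
  rewrite (_ : 2 - 1 = 1 :> R); last by lra.
  by rewrite clamp0 clamp1; have [-> _] := H01 t; have [_ ->] := K01 t.
- move=> s /=; case: ifP => _; first exact: He.
  by have [-> ->] := Ke (clamp (2 * ival s - 1)); rewrite e0 e1.
Qed.

Lemma path_homotopic_cat a a' b b' : a one = b zero ->
  path_homotopic a a' -> path_homotopic b b' ->
  path_homotopic (path_cat a b) (path_cat a' b').
Proof.
move=> ab [H [cH H01 He]] [K [cK K01 Ke]].
exists (fun z => if ival z.2 <= 2^-1 then H (z.1, clamp (2 * ival z.2))
                 else K (z.1, clamp (2 * ival z.2 - 1))); split.
- apply: paste_continuous.
  + exact: (comp2_continuous (@snd_continuous I I) (@ival_continuous R)).
  + apply: (comp2_continuous (f := fun z : I * I => (z.1, clamp (2 * ival z.2)))) cH.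
    apply: pair_continuous; first exact: fst_continuous.
    exact: (clamp_mul_continuous (@snd_continuous I I)).
  + apply: (comp2_continuous (f := fun z : I * I => (z.1, clamp (2 * ival z.2 - 1)))) cK.
    apply: pair_continuous; first exact: fst_continuous.
    exact: (clamp_affine_continuous (@snd_continuous I I)).
  + move=> z ->; rewrite half2 subrr clamp1 clamp0.
    by have [_ ->] := He z.1; have [-> _] := Ke z.1.
- move=> t; rewrite /path_cat /=; case: ifP => _; [exact: H01|exact: K01].
- move=> s; rewrite path_cat0 path_cat1 /= ival0 ival1 half_lt1 invr_ge0 ler0n.
  rewrite mulr0 mulr1 (_ : 2 - 1 = 1 :> R); last by lra.
  by rewrite clamp0 clamp1; have [-> _] := He s; have [_ ->] := Ke s.
Qed.

Lemma path_homotopic_rev a b : path_homotopic a b ->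
  path_homotopic (path_rev a) (path_rev b).
Proof.
case=> H [cH H01 He]; exists (fun z => H (z.1, clamp (1 - ival z.2))); split.
- apply: (comp2_continuous (f := fun z : I * I => (z.1, clamp (1 - ival z.2)))) cH.
  apply: pair_continuous; first exact: fst_continuous.
  exact: (clamp_rev_continuous (@snd_continuous I I)).
- by move=> t; exact: H01.
- move=> s; rewrite path_rev0 path_rev1 /= ival0 ival1 subr0 subrr.
  by rewrite clamp0 clamp1; have [-> ->] := He s.
Qed.

Lemma clamp_le0 (t : R) : t <= 0 -> clamp t = zero :> I.
Proof.
move=> t0; apply: ival_inj; rewrite ival0 /ival set_valE /=.
by rewrite max_l// ge_min t0 orbT.
Qed.

Lemma clamp_ge1 (t : R) : 1 <= t -> clamp t = one :> I.
Proof.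
move=> t1; apply: ival_inj; rewrite ival1 /ival set_valE /=.
by rewrite min_l// max_r.
Qed.

Lemma ival_clamp (t : R) : ival (clamp t) = Num.max 0 (Num.min 1 t).
Proof. by rewrite /ival set_valE. Qed.

Lemma ivalK_fun (a : I -> X) : a = a \o clamp \o @ival R.
Proof. by apply/funext => t /=; rewrite ivalK. Qed.

Lemma path_reparam_id (c d : I -> X) (phi : I -> R) :
  continuous c -> continuous phi -> phi zero = 0 -> phi one = 1 ->
  (forall t, d t = c (clamp (phi t))) -> path_homotopic d c.
Proof.
move=> cc cphi p0 p1 dE.
have -> : d = c \o clamp \o phi by apply/funext.
rewrite {2}(ivalK_fun c); apply: path_reparam => //.
- exact: ival_continuous.
- by rewrite p0 ival0.
- by rewrite p1 ival1.
Qed.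

Lemma max_affine_continuous (f g : I -> R) :
  continuous f -> continuous g -> continuous (f \max g).
Proof. by move=> cf cg t; apply: (@continuous_max _ I); [exact: cf|exact: cg]. Qed.

Lemma min_affine_continuous (f g : I -> R) :
  continuous f -> continuous g -> continuous (f \min g).
Proof. by move=> cf cg t; apply: (@continuous_min _ I); [exact: cf|exact: cg]. Qed.

Lemma ival_affine_continuous (k l : R) : continuous (fun t : I => k * ival t + l).
Proof. exact: (affine_continuous (@ival_continuous R)). Qed.

Lemma path_cat_cstl a : continuous a ->
  path_homotopic (path_cat (cst (a zero)) a) a.
Proof.
move=> ca.
apply: (path_reparam_id (phi := (fun t => 0 * ival t + 0) \max (fun t => 2 * ival t + -1))) => //.
- by apply: max_affine_continuous; exact: ival_affine_continuous.
- by rewrite /= ival0 max_l; lra.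
- by rewrite /= ival1 max_r; lra.
- move=> t; rewrite /path_cat /= mul0r addr0; case: leP => h.
    by rewrite max_l ?clamp0//; lra.
  by rewrite max_r//; lra.
Qed.

Lemma path_cat_cstr a : continuous a ->
  path_homotopic (path_cat a (cst (a one))) a.
Proof.
move=> ca.
apply: (path_reparam_id (phi := (fun t => 0 * ival t + 1) \min (fun t => 2 * ival t + 0))) => //.
- by apply: min_affine_continuous; exact: ival_affine_continuous.
- by rewrite /= ival0 min_r; lra.
- by rewrite /= ival1 min_l; lra.
- move=> t; rewrite /path_cat /= mul0r add0r addr0; case: leP => h.
    by rewrite min_r//; lra.
  by rewrite min_l ?clamp1//; lra.
Qed.

Lemma path_catA a b c : continuous a -> continuous b -> continuous c ->
  a one = b zero -> b one = c zero ->
  path_homotopic (path_cat a (path_cat b c)) (path_cat (path_cat a b) c).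
Proof.
move=> ca cb cc ab bc.
apply: (path_reparam_id (phi := (fun t => 2^-1 * ival t + 0) \max
  ((fun t => 1 * ival t + - 4^-1) \max (fun t => 2 * ival t + -1)))).
- apply: path_cat_continuous => //; first exact: path_cat_continuous.
  by rewrite path_cat1.
- do 2?[apply: max_affine_continuous => //]; exact: ival_affine_continuous.
- by rewrite /= ival0 max_l ?ge_max; lra.
- rewrite /= ival1 max_r; last by rewrite le_max; lra.
  by rewrite max_r; lra.
- move=> t; have /andP[t0 t1] := ival_itv t; rewrite /path_cat /=.
  case: leP => h1.
    rewrite (@max_l _ _ (2^-1 * ival t + 0)); last by rewrite ge_max; lra.
    rewrite clampE; last by lra.
    rewrite ifT; last by lra.
    rewrite clampE; last by lra.
    by rewrite ifT; [congr (a (clamp _))|]; lra.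
  rewrite clampE; last by lra.
  case: leP => h2.
    rewrite max_r; last by rewrite le_max; lra.
    rewrite max_l; last by lra.
    rewrite clampE; last by lra.
    rewrite ifT; last by lra.
    rewrite clampE; last by lra.
    by rewrite ifF; [congr (b (clamp _))|]; lra.
  rewrite max_r; last by rewrite le_max; lra.
  rewrite max_r; last by lra.
  rewrite clampE; last by lra.
  by rewrite ifF; [congr (c (clamp _))|]; lra.
Qed.

Lemma path_catV a : continuous a ->
  path_homotopic (path_cat a (path_rev a)) (cst (a zero)).
Proof.
move=> ca.
have -> : path_cat a (path_rev a) =
  a \o clamp \o ((fun t => 2 * ival t + 0) \min (fun t => (-2) * ival t + 2)).
  apply/funext => t; have /andP[t0 t1] := ival_itv t.
  rewrite /path_cat /path_rev /=; case: leP => h.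
    by rewrite min_l ?addr0//; lra.
  rewrite min_r; last by lra.
  rewrite clampE; last by lra.
  by congr (a (clamp _)); lra.
have -> : cst (a zero) = a \o clamp \o (fun t : I => 0 * ival t + 0).
  by apply/funext => t; rewrite /= mul0r addr0 clamp0.
apply: path_reparam => //.
- by apply: min_affine_continuous; exact: ival_affine_continuous.
- exact: ival_affine_continuous.
- by rewrite /= ival0 min_l; lra.
- by rewrite /= ival1 min_r; lra.
Qed.

Lemma path_revK a : path_rev (path_rev a) = a.
Proof.
apply/funext => t; have /andP[t0 t1] := ival_itv t; rewrite /path_rev clampE; last by lra.
by rewrite subKr ivalK.
Qed.

Lemma path_catVr a : continuous a ->
  path_homotopic (path_cat (path_rev a) a) (cst (a one)).
Proof.
move=> ca; have := path_catV (path_rev_continuous ca).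
by rewrite path_revK path_rev0.
Qed.

End path_homotopy.

Section fundamental_group.
Context (R : realType) (X : topologicalType) (x0 : X).
Local Notation I := (unit_itv R).
Local Notation loop := {path I from x0 to x0}.

Definition loop_homotopic (a b : loop) : bool := `[< path_homotopic a b >].

Lemma loop_homotopic_refl : reflexive loop_homotopic.
Proof. by move=> a; apply/asboolP/path_homotopic_refl/cts_fun. Qed.

Lemma loop_homotopic_sym : symmetric loop_homotopic.
Proof. by move=> a b; apply/asboolP/asboolP => /path_homotopic_sym. Qed.

Lemma loop_homotopic_trans : transitive loop_homotopic.
Proof.
by move=> b a c /asboolP ab /asboolP bc; apply/asboolP/(path_homotopic_trans ab).
Qed.

Definition loop_equiv := EquivRel loop_homotopic
  loop_homotopic_refl loop_homotopic_sym loop_homotopic_trans.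

Definition pi1 := {eq_quot loop_equiv}.
HB.instance Definition _ := Choice.on pi1.
HB.instance Definition _ := EqQuotient.on pi1.

Definition loop_class (a : loop) : pi1 := \pi_pi1 a.

Lemma loop_classP a b : loop_class a = loop_class b <-> path_homotopic a b.
Proof.
split=> [/eqmodP/asboolP //|ab].
by apply/eqmodP; exact/asboolP.
Qed.

Lemma loop_cat_continuous (a b : loop) : continuous (path_cat a b).
Proof.
by apply: path_cat_continuous; rewrite ?path_one ?path_zero//; exact: cts_fun.
Qed.

Lemma loop_cat0 (a b : loop) : path_cat a b zero = x0.
Proof. by rewrite path_cat0 path_zero. Qed.

Lemma loop_cat1 (a b : loop) : path_cat a b one = x0.
Proof. by rewrite path_cat1 path_one. Qed.

Definition loop_cat (a b : loop) : loop :=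
  mk_path (@loop_cat_continuous a b) (loop_cat0 a b) (loop_cat1 a b).

Lemma loop_rev_continuous (a : loop) : continuous (path_rev a).
Proof. by apply: path_rev_continuous; exact: cts_fun. Qed.

Lemma loop_rev0 (a : loop) : path_rev a zero = x0.
Proof. by rewrite path_rev0 path_one. Qed.

Lemma loop_rev1 (a : loop) : path_rev a one = x0.
Proof. by rewrite path_rev1 path_zero. Qed.

Definition loop_rev (a : loop) : loop :=
  mk_path (@loop_rev_continuous a) (loop_rev0 a) (loop_rev1 a).

Definition loop_cst : loop := cst x0.

Definition pi1_one : pi1 := loop_class loop_cst.
Definition pi1_inv (a : pi1) : pi1 := loop_class (loop_rev (repr a)).
Definition pi1_mul (a b : pi1) : pi1 := loop_class (loop_cat (repr a) (repr b)).

Lemma repr_loop_class a : path_homotopic (repr (loop_class a)) a.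
Proof. by apply/loop_classP; rewrite /loop_class reprK. Qed.

Lemma pi1W (P : pi1 -> Prop) : (forall a, P (loop_class a)) -> forall a, P a.
Proof. by move=> h a; rewrite -[a]reprK; exact: h. Qed.

Lemma pi1_mulE a b :
  pi1_mul (loop_class a) (loop_class b) = loop_class (loop_cat a b).
Proof.
apply/loop_classP/path_homotopic_cat; first by rewrite path_zero path_one.
  exact: repr_loop_class.
exact: repr_loop_class.
Qed.

Lemma pi1_invE a : pi1_inv (loop_class a) = loop_class (loop_rev a).
Proof. exact/loop_classP/path_homotopic_rev/repr_loop_class. Qed.

Lemma pi1_mulA : associative pi1_mul.
Proof.
elim/pi1W => a; elim/pi1W => b; elim/pi1W => c; rewrite !pi1_mulE.
by apply/loop_classP/path_catA; rewrite ?path_one ?path_zero//; exact: cts_fun.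
Qed.

Lemma pi1_mul1g : left_id pi1_one pi1_mul.
Proof.
elim/pi1W => a; rewrite pi1_mulE; apply/loop_classP.
by have := @path_cat_cstl R X a (@cts_fun _ _ a); rewrite path_zero.
Qed.

Lemma pi1_mulg1 : right_id pi1_one pi1_mul.
Proof.
elim/pi1W => a; rewrite pi1_mulE; apply/loop_classP.
by have := @path_cat_cstr R X a (@cts_fun _ _ a); rewrite path_one.
Qed.

Lemma pi1_mulVg : left_inverse pi1_one pi1_inv pi1_mul.
Proof.
elim/pi1W => a; rewrite pi1_invE pi1_mulE; apply/loop_classP.
by have := @path_catVr R X a (@cts_fun _ _ a); rewrite path_one.
Qed.

Lemma pi1_mulgV : right_inverse pi1_one pi1_inv pi1_mul.
Proof.
elim/pi1W => a; rewrite pi1_invE pi1_mulE; apply/loop_classP.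
by have := @path_catV R X a (@cts_fun _ _ a); rewrite path_zero.
Qed.

HB.instance Definition _ := isGroup.Build pi1
  pi1_mulA pi1_mul1g pi1_mulg1 pi1_mulVg pi1_mulgV.

End fundamental_group.

Section induced.
Context (R : realType) (X : topologicalType) (x0 : X).
Local Notation I := (unit_itv R).
Local Notation loop := {path I from x0 to x0}.
Context (f : continuousType X X) (f0 : f x0 = x0).

Lemma loop_map_continuous (a : loop) : continuous (f \o a).
Proof. by apply: comp2_continuous; exact: cts_fun. Qed.

Lemma loop_map0 (a : loop) : (f \o a) zero = x0.
Proof. by rewrite /= path_zero. Qed.

Lemma loop_map1 (a : loop) : (f \o a) one = x0.
Proof. by rewrite /= path_one. Qed.

Definition loop_map (a : loop) : loop :=
  mk_path (@loop_map_continuous a) (loop_map0 a) (loop_map1 a).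

Definition induced (a : pi1 R x0) : pi1 R x0 := loop_class (loop_map (repr a)).

Lemma path_homotopic_comp (a b : I -> X) :
  path_homotopic a b -> path_homotopic (f \o a) (f \o b).
Proof.
case=> H [cH H01 He]; exists (f \o H); split.
- by apply: comp2_continuous => //; exact: cts_fun.
- by move=> t /=; have [-> ->] := H01 t.
- by move=> s /=; have [-> ->] := He s.
Qed.

Lemma inducedE a : induced (loop_class a) = loop_class (loop_map a).
Proof. exact/loop_classP/path_homotopic_comp/repr_loop_class. Qed.

Lemma inducedM : {morph induced : a b / (a * b)%g}.
Proof.
elim/pi1W => a; elim/pi1W => b.
rewrite [LHS](congr1 induced (pi1_mulE a b)) !inducedE.
rewrite [RHS]pi1_mulE; congr loop_class; apply/path_eqP => t /=.
by rewrite /mk_path /path_cat /=; case: ifP.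
Qed.

Lemma induced1 : induced 1%g = 1%g.
Proof.
rewrite [LHS]inducedE; congr loop_class; apply/path_eqP => t /=.
exact: f0.
Qed.

HB.instance Definition _ := isMultiplicative.Build _ _ induced inducedM.
HB.instance Definition _ :=
  Multiplicative_isUMagmaMorphism.Build _ _ induced induced1.

End induced.

Section manifold.
Context (R : realType) (d : nat) (X : topologicalType).
Local Notation I := (unit_itv R).
Local Notation E := 'rV[R]_d.

Record chart := Chart {
  chart_dom : set X;
  chart_map :> X -> E;
  chart_inv : E -> X;
  chart_dom_open : open chart_dom;
  chart_codom_open : open (chart_map @` chart_dom);
  chart_continuous : {within chart_dom, continuous chart_map};
  chart_inv_continuous : {within chart_map @` chart_dom, continuous chart_inv};
  chartK : {in chart_dom, cancel chart_map chart_inv} }.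

Definition closed_connected_manifold :=
  [/\ hausdorff_space X, @second_countable X, compact [set: X],
      connected [set: X] & forall x, exists phi : chart, chart_dom phi x].

(* [h] has local degree 1 at its isolated zero [p]: near [p] it is homotopic,
   through maps vanishing only at [p], to the translation [z - p]. *)
Definition positive_germ (h : E -> E) (p : E) :=
  exists (U : set E) (H : (I * E)%type -> E),
  [/\ open_nbhs p U,
      forall t z, U z -> {for (t, z), continuous H},
      forall z, U z -> H (zero, z) = h z /\ H (one, z) = z - p
    & forall t z, U z -> H (t, z) = 0 <-> z = p].

Definition same_orientation (phi psi : chart) (x : X) :=
  positive_germ (fun z => psi (chart_inv phi z) - psi x) (phi x).

Definition oriented_atlas (O : set chart) :=
  (forall x, exists2 phi, O phi & chart_dom phi x) /\
  (forall phi psi x, O phi -> O psi -> chart_dom phi x -> chart_dom psi x ->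
    same_orientation phi psi x).

Definition orientable := exists O, oriented_atlas O.

(* At a coincidence [x] of [u] and [v], with [phi] a chart at [x] and [psi] a
   chart at [u x = v x]. The difference is taken in the order [v - u], so that
   for [v = id] the sign is that of the fixed point index. *)
Definition positive_coincidence (u v : X -> X) (phi psi : chart) (x : X) :=
  positive_germ
    (fun z => psi (v (chart_inv phi z)) - psi (u (chart_inv phi z))) (phi x).

(* In a chart of the target, [v - u] is a local homeomorphism at each
   coincidence. *)
Definition transverse (u v : X -> X) := forall x, u x = v x ->
  exists (psi : chart) (U : set X),
  [/\ open_nbhs x U, u @` U `<=` chart_dom psi, v @` U `<=` chart_dom psi,
      {in U &, injective (fun y => psi (v y) - psi (u y))}
    & forall V, open V -> V `<=` U ->
        open ((fun y => psi (v y) - psi (u y)) @` V)].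

Definition nielsen_related (u v : X -> X) (x y : X) :=
  exists c : {path I from x to y}, path_homotopic (u \o c) (v \o c).

Definition coincidence_class (u v : X -> X) (A : set X) :=
  exists2 x, u x = v x &
    A = [set y | u y = v y /\ nielsen_related u v x y].

Definition deforms (u : X -> X) (F : (I * X)%type -> X) :=
  continuous F /\ forall x, F (zero, x) = u x.

Definition final (F : (I * X)%type -> X) : X -> X := fun x => F (one, x).

(* The class of the deformed pair corresponding to the class [A]; it may be
   empty. *)
Definition carried_class (F G : (I * X)%type -> X) (A : set X) : set X :=
  [set y | final F y = final G y /\ exists2 x, A x &
    exists c : {path I from x to y},
      path_homotopic (fun t => F (t, c t)) (fun t => G (t, c t))].

Definition index_sign (O : set chart) (u v : X -> X) (x : X) : int :=
  if `[< exists phi psi, [/\ O phi, O psi, chart_dom phi x,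
         chart_dom psi (u x) & positive_coincidence u v phi psi x] >]
  then 1 else -1.

(* The coincidence index of a class is the signed count of the corresponding
   coincidences of a transverse pair to which [u], [v] are deformed. *)
Definition is_index (u v : X -> X) (A : set X) (k : int) :=
  exists O F G, [/\ oriented_atlas O, deforms u F, deforms v G,
    transverse (final F) (final G)
  & k = \sum_(y \in carried_class F G A) index_sign O (final F) (final G) y].

(* [chi] is a continuous transport of a local orientation along [c]. *)
Definition charts_along (c : I -> X) (chi : I -> chart) := forall t,
  chart_dom (chi t) (c t) /\
  \forall s \near t, chart_dom (chi t) (c s) /\
                     same_orientation (chi t) (chi s) (c s).

(* Two coincidences of a transverse pair reduce each other when some path
   establishing their Nielsen relation is graph-orientation-reversing. *)
Definition reduce_each_other (u v : X -> X) (x y : X) :=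
  exists (c : {path I from x to y}) (chi psi : I -> chart),
  [/\ path_homotopic (u \o c) (v \o c), charts_along c chi,
      charts_along (u \o c) psi
    & ~ (positive_coincidence u v (chi zero) (psi zero) x <->
         positive_coincidence u v (chi one) (psi one) y)].

(* The semi-index (Dobrenko-Jezierski): the involution [s] pairs off mutually
   reducing coincidences of the transverse pair, and the semi-index is the
   number of the remaining (free) ones, no two of which reduce each other. *)
Definition is_semi_index (u v : X -> X) (A : set X) (r : nat) :=
  exists F G (s : X -> X),
  let B := carried_class F G A in
  let free := [set x | B x /\ s x = x] in
  let reducing := reduce_each_other (final F) (final G) in
  [/\ [/\ deforms u F, deforms v G & transverse (final F) (final G)],
      forall x, B x -> [/\ B (s x), s (s x) = x & s x <> x -> reducing x (s x)],
      forall x y, free x -> free y -> x <> y -> ~ reducing x y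
    & (free #= `I_r)%card].

Definition coincidence_index (u v : X -> X) (A : set X) : int :=
  xget 0 [set k | (orientable /\ is_index u v A k) \/
                  (~ orientable /\ exists2 r, is_semi_index u v A r & k = r%:Z)].

End manifold.

Section reidemeister.
Context (R : realType) (d : nat) (X : topologicalType) (x0 : X).
Context (f g : continuousType X X) (f0 : f x0 = x0) (g0 : g x0 = x0).
Local Notation I := (unit_itv R).
Local Notation loop := {path I from x0 to x0}.
Local Notation pi := (pi1 R x0).
Local Notation fs := (induced (R := R) f0).
Local Notation gs := (induced (R := R) g0).
Implicit Types (n m k : nat) (a b c : pi).

Definition reidemeister_eq n a b :=
  exists c, a = (iter n gs c * b * iter n fs c^-1)%g.

Definition reidemeister_class n a : set pi := [set b | reidemeister_eq n a b].

(* The union of the Reidemeister classes [g^n(c) f^n(c^-1)] over all choices of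
   [c]; it is a single class when [A] is a Nielsen class. *)
Definition rho n (A : set X) : set pi :=
  [set a | exists x (c : {path I from x0 to x}) (l : loop),
    [/\ A x,
        l = path_cat (iter n g \o c) (path_rev (iter n f \o c)) :> (I -> X)
      & reidemeister_class n (loop_class l) a]].

Definition Ind n a : int :=
  xget 0 [set k | exists A,
    [/\ coincidence_class R (iter n f) (iter n g) A,
        rho n A = reidemeister_class n a
      & k = coincidence_index R d (iter n f) (iter n g) A]].

Definition essential n a := Ind n a <> 0.

Definition boost m n a : pi :=
  (\prod_(i < n %/ m) iter (n - i.+1 * m) gs (iter (i * m) fs a))%g.

Definition reduces n a m b :=
  (m %| n)%N /\ reidemeister_class n (boost m n b) = reidemeister_class n a.

Definition essentially_reducible := forall n a m b, (0 < n)%N ->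
  essential n a -> reduces n a m b -> essential m b.

Definition injective_on_essential_boosts := forall n m b1 b2, (0 < n)%N ->
  (m %| n)%N ->
  reidemeister_class n (boost m n b1) = reidemeister_class n (boost m n b2) ->
  essential n (boost m n b1) ->
  reidemeister_class m b1 = reidemeister_class m b2.

Definition essentially_reducible_to_gcd := essentially_reducible /\
  forall n a m b k c, (0 < n)%N ->
  essential n a -> essential m b -> essential k c ->
  reduces n a m b -> reduces n a k c ->
  exists e : pi, [/\ essential (gcdn m k) e,
    reduces m b (gcdn m k) e & reduces k c (gcdn m k) e].

End reidemeister.

(* Main.v *)
Require Import Defs.
From HB Require Import structures.
From mathcomp Require Import all_boot all_order all_algebra.
From mathcomp Require Import all_classical all_reals topology normedtype.

(** Write the abelian group [pi1] additively and let [F], [G] be the commuting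
    endomorphisms induced by [f], [g].  Reidemeister classes at level [n] are
    the cosets of the image of [G^n - F^n], and boosting from [m] to [n] is the
    homogeneous geometric sum [h(m,n)], formally the quotient
    [(G^n - F^n) / (G^m - F^m)]; hence [h(m,n) h(d,m) = h(d,n)].

    Suppose [alpha = h(m,n) b] and [alpha = h(k,n) c] modulo the image of
    [G^n - F^n], and let [d = gcd(m,k)].  A Bezout relation [p m = q k + d]
    between the levels lifts to one between operators: splitting off the first
    term of a geometric sum gives [h(d,qk+d) = G^(qk) + F^d h(d,qk)], that is

      [G^(qk) = h(m,pm) h(d,m) - F^d h(k,qk) h(d,k)]    ([bezout_gsum]).

    Applied to [alpha], this exhibits [G^(qk) alpha], modulo the image of
    [G^n - F^n], as [h(d,n)] of [h(m,pm) b - F^d h(k,qk) c]; since [G] is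
    invertible, [alpha] itself is boosted from some [e] at level [d]
    ([common_origin]).  Essential
    reducibility makes [e] essential, and injectivity on essential boosts
    cancels [h(m,n)] in [h(m,n) h(d,m) e = h(m,n) b], so that [e] boosts to the
    class of [b]; likewise for [c]. *)

Set Implicit Arguments.
Unset Strict Implicit.
Unset Printing Implicit Defensive.

(** * Geometric sums of two commuting endomorphisms *)

Section GeometricSums.
Context (T : groupType) (F G : {multiplicative T -> T}).
Context (mulTC : forall a b : T, (a * b = b * a)%g).
Context (FG : forall a, F (G a) = G (F a)).
Local Open Scope group_scope.

(** The operator [h(m,qm)], formally [(G^(qm) - F^(qm)) / (G^m - F^m)].  It is
    indexed by its number [q] of terms, which keeps truncated subtraction and
    division out of the identities below. *)
Definition gsum m q (a : T) : T :=
  \prod_(i < q) iter ((q - i.+1) * m) G (iter (i * m) F a).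

Definition twisted_eq n (a b : T) :=
  exists c, a = iter n G c * b * iter n F c^-1.

(** The endomorphisms commuting with [F] and [G]: they descend to twisted
    classes and commute with every [gsum]. *)
Definition equivariant (H : T -> T) :=
  [/\ {morph H : a b / a * b}, forall a, H (F a) = F (H a)
    & forall a, H (G a) = G (H a)].

Let mulTACA (a b c e : T) : (a * b) * (c * e) = (a * c) * (b * e).
Proof. by rewrite !mulgA -(mulgA a b) (mulTC b) mulgA. Qed.

Lemma equivariant_iter n H : equivariant H -> equivariant (iter n H).
Proof.
move=> [HM HF HG]; split.
- by elim: n => // n IHn a b; rewrite /= IHn HM.
- by elim: n => // n IHn a /=; rewrite IHn HF.
- by elim: n => // n IHn a /=; rewrite IHn HG.
Qed.

Lemma equivariant_comp H K :
  equivariant H -> equivariant K -> equivariant (fun a => H (K a)).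
Proof.
move=> [HM HF HG] [KM KF KG]; split=> [a b|a|a].
- by rewrite KM HM.
- by rewrite KF HF.
- by rewrite KG HG.
Qed.

Lemma equivariantF : equivariant F.
Proof. by split=> [a b|a|a] //; rewrite gmulfM. Qed.

Lemma equivariantG : equivariant G.
Proof. by split=> [a b|a|a] //; rewrite gmulfM. Qed.

Lemma equivariant_inv Gi : cancel G Gi -> cancel Gi G -> equivariant Gi.
Proof.
move=> GK GiK; split=> [a b|a|a].
- exact: (can2_gmulfM GK GiK).
- by rewrite -{1}(GiK a) FG GK.
- by rewrite GK GiK.
Qed.

Lemma equivariant1 H : equivariant H -> H 1 = 1.
Proof. by case=> HM _ _; apply: (mulgI (H 1)); rewrite -HM !mulg1. Qed.

Lemma equivariantV H a : equivariant H -> H a^-1 = (H a)^-1.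
Proof.
move=> HE; have [HM _ _] := HE; apply: (mulgI (H a)).
by rewrite -HM !mulgV equivariant1.
Qed.

Lemma equivariant_iterF n H a : equivariant H -> H (iter n F a) = iter n F (H a).
Proof. by case=> _ HF _; elim: n => //= n IHn; rewrite HF IHn. Qed.

Lemma equivariant_iterG n H a : equivariant H -> H (iter n G a) = iter n G (H a).
Proof. by case=> _ _ HG; elim: n => //= n IHn; rewrite HG IHn. Qed.

Lemma gsumS m q a :
  gsum m q.+1 a = iter (q * m) G a * iter m F (gsum m q a).
Proof.
rewrite /gsum big_ord_recl subn1; congr (_ * _).
have [FM _ _] := equivariant_iter m equivariantF.
rewrite (big_morph _ FM (equivariant1 (equivariant_iter m equivariantF))).
apply: eq_bigr => i _; rewrite (equivariant_iterG _ _ (equivariant_iter m equivariantF)).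
by rewrite -iterD -mulSn subSS.
Qed.

Lemma gsum_equivariant m q H a : equivariant H -> gsum m q (H a) = H (gsum m q a).
Proof.
move=> HE; have [HM _ _] := HE.
rewrite /gsum (big_morph H HM (equivariant1 HE)).
by apply: eq_bigr => i _; rewrite (equivariant_iterG _ _ HE) (equivariant_iterF _ _ HE).
Qed.

Lemma equivariant_gsum m q : equivariant (gsum m q).
Proof.
split=> [|a|a]; try exact: gsum_equivariant.
- elim: q => [|q IHq] a b; first by rewrite /gsum !big_ord0 mulg1.
  have [FM _ _] := equivariant_iter m equivariantF.
  have [GM _ _] := equivariant_iter (q * m) equivariantG.
  by rewrite !gsumS IHq FM GM mulTACA.
- exact: gsum_equivariant equivariantF.
- exact: gsum_equivariant equivariantG.
Qed.

Lemma gsumD m p q a :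
  gsum m (p + q) a = iter (q * m) G (gsum m p a) * iter (p * m) F (gsum m q a).
Proof.
have FE := equivariant_iter m equivariantF; have [FM _ _] := FE.
have GE := equivariant_iter (q * m) equivariantG; have [GM _ _] := GE.
elim: p => [|p IHp].
  by rewrite [gsum m 0 a]/gsum big_ord0 (equivariant1 GE) mul1g.
rewrite addSn !gsumS IHp FM GM mulgA mulSn iterD; congr (_ * _ * _).
  by rewrite mulnDl addnC iterD.
by rewrite (equivariant_iterG _ _ FE).
Qed.

(** Boosting is functorial: [h(sm,qsm) h(m,sm) = h(m,qsm)]. *)
Lemma gsum_comp m s q a : gsum (s * m) q (gsum m s a) = gsum m (q * s) a.
Proof.
elim: q => [|q IHq]; first by rewrite /gsum !big_ord0.
by rewrite gsumS IHq mulSn gsumD mulnA.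
Qed.

(** The operators [h(d,ud)] and [h(d,vd)] are comaximal up to a power of [G]
    when [u] and [v] are coprime: [h(d,(qv+1)d)] factors through the first,
    and what remains after its leading term through the second. *)
Lemma bezout_gsum d u v p q a : (p * u = (q * v).+1)%N ->
  gsum (u * d) p (gsum d u a) / iter d F (gsum (v * d) q (gsum d v a)) =
  iter (q * v * d) G a.
Proof. by move=> puqv; rewrite !gsum_comp puqv gsumS mulgK. Qed.

Lemma twisted_eq_refl n a : twisted_eq n a a.
Proof.
exists 1; rewrite invg1 (equivariant1 (equivariant_iter n equivariantG)).
by rewrite (equivariant1 (equivariant_iter n equivariantF)) mul1g mulg1.
Qed.

Lemma twisted_eq_sym n a b : twisted_eq n a b -> twisted_eq n b a.
Proof.
case=> c ->; exists c^-1.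
rewrite (equivariantV c (equivariant_iter n equivariantG)).
rewrite (equivariantV c (equivariant_iter n equivariantF)) invgK.
by rewrite !mulgA mulVg mul1g mulgVK.
Qed.

Lemma twisted_eq_mul n a b a' b' :
  twisted_eq n a b -> twisted_eq n a' b' -> twisted_eq n (a * a') (b * b').
Proof.
move=> [c ->] [c' ->]; exists (c * c').
have [FM _ _] := equivariant_iter n equivariantF.
have [GM _ _] := equivariant_iter n equivariantG.
by rewrite invgM (mulTC c'^-1) FM GM mulTACA (mulTACA (iter n G c)).
Qed.

Lemma twisted_eq_trans n a b c :
  twisted_eq n a b -> twisted_eq n b c -> twisted_eq n a c.
Proof.
move=> [x ->] [y ->]; exists (x * y).
have [FM _ _] := equivariant_iter n equivariantF.
have [GM _ _] := equivariant_iter n equivariantG.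
by rewrite invgM FM GM !mulgA.
Qed.

Lemma twisted_eq_equivariant n H a b :
  equivariant H -> twisted_eq n a b -> twisted_eq n (H a) (H b).
Proof.
move=> HE [c ->]; have [HM _ _] := HE; exists (H c).
by rewrite !HM (equivariant_iterG _ _ HE) (equivariant_iterF _ _ HE) equivariantV.
Qed.

Lemma twisted_eq_inv n a b : twisted_eq n a b -> twisted_eq n a^-1 b^-1.
Proof.
apply: (twisted_eq_equivariant (H := fun x => x^-1)); split=> [x y|x|x].
- by rewrite invgM mulTC.
- by rewrite (equivariantV x equivariantF).
- by rewrite (equivariantV x equivariantG).
Qed.

(** If boosts from levels [u d] and [v d] of multiplicity [P] and [Q] land in
    one class, [u] and [v] being coprime, then this class already comes from
    level [d].  The representative at level [d] is the Bezout combination of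
    the two given ones, divided by the power of [G] in [bezout_gsum]. *)
Lemma common_origin n d u v p q P Q b c : bijective G ->
  (p * u = (q * v).+1)%N -> (P * u = Q * v)%N ->
  twisted_eq n (gsum (u * d) P b) (gsum (v * d) Q c) ->
  exists e, twisted_eq n (gsum d (P * u) e) (gsum (u * d) P b).
Proof.
case=> Gi GK GiK puqv PuQv bc; set s := (q * v * d)%N.
have GiE := equivariant_iter s (equivariant_inv GK GiK).
have GsK : cancel (iter s G) (iter s Gi).
  by move=> a; elim: s {GiE} a => // s IHs a; rewrite iterSr /= GK IHs.
have L1E := equivariant_gsum (u * d) p.
have L2E := equivariant_comp (equivariant_iter d equivariantF)
                             (equivariant_gsum (v * d) q).
exists (iter s Gi (gsum (u * d) p b / iter d F (gsum (v * d) q c))).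
rewrite (gsum_equivariant _ _ _ GiE) -[gsum (u * d) P b]GsK.
apply: twisted_eq_equivariant => //.
have [hM _ _] := equivariant_gsum d (P * u).
rewrite hM equivariantV ?(gsum_equivariant _ _ _ L1E) ?(gsum_equivariant _ _ _ L2E);
  last exact: equivariant_gsum.
(* Both terms factor through one of the two boosts assumed to agree. *)
have -> : gsum d (P * u) b = gsum d u (gsum (u * d) P b).
  by rewrite (gsum_equivariant _ _ _ (equivariant_gsum _ _)) gsum_comp.
have -> : gsum d (P * u) c = gsum d v (gsum (v * d) Q c).
  by rewrite (gsum_equivariant _ _ _ (equivariant_gsum _ _)) gsum_comp PuQv.
rewrite -(bezout_gsum d _ puqv).
apply: twisted_eq_mul; first exact: twisted_eq_refl.
apply/twisted_eq_inv/(twisted_eq_equivariant L2E).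
apply: (twisted_eq_equivariant (equivariant_gsum d v)).
exact: twisted_eq_sym.
Qed.

End GeometricSums.

(** * Reidemeister classes and boosts *)

Section Boosts.
Context (R : realType) (d : nat) (X : topologicalType) (x0 : X).
Context (f g : continuousType X X) (f0 : f x0 = x0) (g0 : g x0 = x0).
Local Notation F := (induced (R := R) f0).
Local Notation G := (induced (R := R) g0).

Lemma boost_gsum m q a : (0 < m)%N ->
  boost f0 g0 m (q * m) a = gsum F G m q a.
Proof.
move=> m0; rewrite /boost /gsum mulnK//.
by apply: eq_bigr => i _; rewrite mulnBl.
Qed.

Lemma reidemeister_class_eqP n (a b : pi1 R x0) :
  (forall x, F (G x) = G (F x)) ->
  reidemeister_class f0 g0 n a = reidemeister_class f0 g0 n b <->
  twisted_eq F G n a b.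
Proof.
move=> FG; split=> [ab|ab].
  have : reidemeister_class f0 g0 n b b by exact: (twisted_eq_refl FG).
  by rewrite -ab.
apply/seteqP; split=> x /= xab.
  exact: (twisted_eq_trans FG (twisted_eq_sym FG ab) xab).
exact: (twisted_eq_trans FG ab xab).
Qed.

Lemma essential_class n (a b : pi1 R x0) :
  reidemeister_class f0 g0 n a = reidemeister_class f0 g0 n b ->
  essential d f0 g0 n a -> essential d f0 g0 n b.
Proof. by move=> ab; rewrite /essential /Ind ab. Qed.

End Boosts.

Theorem theorem4p16 (R : realType) (d : nat) (X : topologicalType) (x0 : X)
    (f g : continuousType X X) (f0 : f x0 = x0) (g0 : g x0 = x0)
    (X_mfd : closed_connected_manifold R d X)
    (pi1_abelian : forall a b : pi1 R x0, (a * b = b * a)%g)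
    (fg_red : essentially_reducible R d f0 g0)
    (fg_comm : forall a : pi1 R x0,
       induced f0 (induced g0 a) = induced g0 (induced f0 a))
    (fg_inj : injective_on_essential_boosts R d f0 g0)
    (g_inv : bijective (induced (R := R) g0)) :
  essentially_reducible_to_gcd R d f0 g0.
Proof.
split=> // n a m b k c n0 ess_a ess_b ess_c [mn bn] [kn cn].
have m0 : (0 < m)%N by exact: dvdn_gt0 mn.
have k0 : (0 < k)%N by exact: dvdn_gt0 kn.
have d0 : (0 < gcdn m k)%N by rewrite gcdn_gt0 m0.
case: (egcdnP k m0) => p q pq _.
set D := gcdn m k in d0 pq *.
have [u uE] : exists u, m = (u * D)%N by apply/dvdnP; exact: dvdn_gcdl.
have [v vE] : exists v, k = (v * D)%N by apply/dvdnP; exact: dvdn_gcdr.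
move/dvdnP: (mn) => [P PE]; move/dvdnP: (kn) => [Q QE].
have puqv : (p * u = (q * v).+1)%N.
  by apply/eqP; rewrite -(eqn_pmul2r d0) mulSn addnC -!mulnA -uE -vE pq.
have PuQv : (P * u = Q * v)%N.
  by apply/eqP; rewrite -(eqn_pmul2r d0) -!mulnA -uE -vE -PE -QE.
have nE : n = (P * u * D)%N by rewrite -mulnA -uE.
have bE : boost f0 g0 m n b = gsum (induced f0) (induced g0) (u * D) P b.
  by rewrite PE boost_gsum// uE.
have cE : boost f0 g0 k n c = gsum (induced f0) (induced g0) (v * D) Q c.
  by rewrite QE boost_gsum// vE.
have [e en] : exists e, reidemeister_class f0 g0 n (boost f0 g0 D n e) =
                        reidemeister_class f0 g0 n a.
  have bc := etrans bn (esym cn); rewrite bE cE in bc.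
  move/(reidemeister_class_eqP _ _ _ fg_comm): bc => bc.
  have [e eb] := common_origin pi1_abelian fg_comm g_inv puqv PuQv bc.
  exists e; rewrite -bn bE {2}nE boost_gsum//.
  exact/(reidemeister_class_eqP _ _ _ fg_comm).
have boostDm : boost f0 g0 m n (boost f0 g0 D m e) = boost f0 g0 D n e.
  rewrite [in RHS]nE boost_gsum// PE boost_gsum// uE.
  by rewrite boost_gsum// gsum_comp.
have boostDk : boost f0 g0 k n (boost f0 g0 D k e) = boost f0 g0 D n e.
  rewrite [in RHS]nE PuQv boost_gsum// QE boost_gsum// vE.
  by rewrite boost_gsum// gsum_comp.
have Dm : (D %| m)%N by exact: dvdn_gcdl.
have Dk : (D %| k)%N by exact: dvdn_gcdr.
have ess_e := essential_class (esym en) ess_a.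
exists e; split.
- apply: fg_red n0 ess_a _; split=> //; exact: dvdn_trans Dm mn.
- split=> //; apply: fg_inj n0 mn _ _; rewrite boostDm ?bn//.
- split=> //; apply: fg_inj n0 kn _ _; rewrite boostDk ?cn//.
Qed.
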